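(* Let $(\mathbb{R}^n,g)$ be a pseudo-Euclidean space, $n\ge3$, with coordinates $x=(x_1,\dots,x_n)$ and $g_{ij}=\delta_{ij}\varepsilon_i$, $\varepsilon_i=\pm1$, and let $m,r\in\mathbb{N}$ with $m,r\ge1$. Let $f(\xi)$ and $\varphi(\xi)$ be any positive differentiable functions, where $\xi=\sum_{i=1}^n\alpha_ix_i$, $\alpha_i\in\mathbb{R}$, and $\sum_{i=1}^n\varepsilon_i\alpha_i^2=0$, and let $h(\xi)$ be given by the ordinary differential equation $$-rf\varphi h''-2rf\varphi'h'+[(n-2)f\varphi''-m\varphi f''-2m\varphi'f']h=0.$$ Then $(M=\mathbb{R}^n\times_fF^m,\widetilde g,h)$ is a quasi-Einstein semi-Riemannian manifold with $\rho=0$, i.e. $\mathrm{Ric}_{\widetilde g}-\frac rh\mathrm{Hess}_{\widetilde g}h=0$, where $\widetilde g=\overline g+f^2g_F$, $\overline g=\frac1{\varphi^2}g$ and $F$ is a Ricci-flat manifold of dimension $m$.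
   Context: Primes denote derivatives with respect to $\xi$; differentiable means smooth. $(F^m,g_F)$ is a semi-Riemannian manifold, and $\mathbb{R}^n\times_fF^m$ is $\mathbb{R}^n\times F$ with the metric $\overline g+f^2g_F$. The solution $h$ is nowhere zero, so that $r/h$ makes sense, and functions of $\xi$ are regarded as functions on $M$ via the projection. A semi-Riemannian manifold $(M,\widetilde g)$ with a nowhere zero smooth function $h$ is quasi-Einstein if $\mathrm{Ric}_{\widetilde g}-\frac rh\mathrm{Hess}_{\widetilde g}h=\rho\,\widetilde g$ for a constant $\rho$. *)

(* Defs.v *)
From HB Require Import structures.
From mathcomp Require Import all_boot all_order all_algebra.
From mathcomp Require Import all_classical all_reals all_analysis.
Import Order.TTheory GRing.Theory Num.Theory.
Import numFieldNormedType.Exports.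

Set Implicit Arguments.
Unset Strict Implicit.
Unset Printing Implicit Defensive.

Local Open Scope ring_scope.
Local Open Scope classical_set_scope.

(* C^oo functions of one real variable; each derivative is continuous because
   the next one exists. *)
Definition smooth1 (R : realType) (u : R -> R) : Prop :=
  forall (k : nat) (t : R), derivable (u^`(k)) t 1.

(* Points of R^d are row vectors. *)
Definition partial (R : realType) (d : nat) (i : 'I_d) (u : 'rV[R]_d -> R) :
    'rV[R]_d -> R :=
  'D_(delta_mx 0 i) u.

(* C^oo on an open set U: every iterated partial derivative exists and is
   continuous at every point of U. The values of u off U are irrelevant. *)
Definition smooth_on (R : realType) (d : nat) (U : set 'rV[R]_d)
    (u : 'rV[R]_d -> R) : Prop :=
  forall (s : seq 'I_d) (x : 'rV[R]_d), U x ->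
    let v := foldr (@partial R d) u s in
    {for x, continuous v} /\ forall i, derivable v x (delta_mx 0 i).

(* Row k lists the k-th partial derivatives, as for the library's 'J. *)
Definition jacobian_mx (R : realType) (d : nat) (tau : 'rV[R]_d -> 'rV[R]_d)
    (x : 'rV[R]_d) : 'M[R]_d :=
  \matrix_(k, l) partial k (fun y => tau y 0 l) x.

(* The symmetric bilinear form G is nondegenerate of index q: the rows of P
   form an orthonormal basis, q of whose vectors have negative square. *)
Definition has_index (R : realType) (d : nat) (G : 'M[R]_d) (q : nat) : Prop :=
  exists (P : 'M[R]_d) (N : {set 'I_d}),
    [/\ P \in unitmx, #|N| = q
      & P *m G *m P^T = diag_mx (\row_i (-1) ^+ (i \in N))].

(* A space with an atlas and the coordinate expressions of a (0,2)-tensor: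
   the chart of index a is coords a, on the domain dom a, with inverse param a,
   and (metric a x) is the Gram matrix of the coordinate vector fields at the
   point param a x. The maps are total, but only their values on dom a,
   respectively on the image chart_image a, are meaningful. *)
Record metric_atlas (R : realType) (d : nat) := MetricAtlas {
  carrier :> topologicalType;
  chart : Type;
  dom : chart -> set carrier;
  coords : chart -> carrier -> 'rV[R]_d;
  param : chart -> 'rV[R]_d -> carrier;
  metric : chart -> 'rV[R]_d -> 'M[R]_d }.

Section SemiRiemannian.
Variables (R : realType) (d : nat) (M : metric_atlas R d).
Implicit Types (a b : chart M) (x : 'rV[R]_d) (i j k l s : 'I_d).

Definition chart_image a : set 'rV[R]_d := coords a @` dom a.

Definition is_smooth_manifold : Prop :=
  [/\ hausdorff_space M /\ @second_countable M,
      forall p : M, exists a, dom a p,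
      forall a, open (dom a) /\ open (chart_image a),
      forall a, [/\ forall p, dom a p -> param a (coords a p) = p,
                    forall p, dom a p -> {for p, continuous (coords a)}
                  & forall x, chart_image a x -> {for x, continuous (param a)}]
    & forall a b l, smooth_on (coords a @` (dom a `&` dom b))
                              (fun x => coords b (param a x) 0 l)].

(* The coordinate expressions are smooth, symmetric, of the same index
   everywhere, and they transform as those of a (0,2)-tensor field. *)
Definition is_metric : Prop :=
  [/\ forall a i j, smooth_on (chart_image a) (fun x => metric a x i j),
      forall a x, chart_image a x -> (metric a x)^T = metric a x,
      exists q, forall a x, chart_image a x -> has_index (metric a x) q
    & forall a b x, (coords a @` (dom a `&` dom b)) x ->
        let tau := fun y => coords b (param a y) in
        metric a x =
          jacobian_mx tau x *m metric b (tau x) *m (jacobian_mx tau x)^T].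

Definition is_semi_riemannian : Prop := is_smooth_manifold /\ is_metric.

Definition smooth_fun (u : M -> R) : Prop :=
  forall a, smooth_on (chart_image a) (fun x => u (param a x)).

(* christoffel a k i j is the symbol with upper index k. *)
Definition christoffel a k i j : 'rV[R]_d -> R := fun x =>
  2^-1 * \sum_l invmx (metric a x) k l *
    (partial i (fun y => metric a y j l) x
     + partial j (fun y => metric a y i l) x
     - partial l (fun y => metric a y i j) x).

(* The l-th component of R(d_i, d_j) d_k, where
   R(X, Y) Z = D_X D_Y Z - D_Y D_X Z - D_[X, Y] Z. *)
Definition riemann a l i j k : 'rV[R]_d -> R := fun x =>
  partial i (christoffel a l j k) x - partial j (christoffel a l i k) x
  + \sum_s (christoffel a l i s x * christoffel a s j k x
            - christoffel a l j s x * christoffel a s i k x).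

(* Ric(Y, Z) is the trace of X |-> R(X, Y) Z. *)
Definition ricci a x : 'M[R]_d := \matrix_(j, k) \sum_i riemann a i i j k x.

Definition hessian (u : M -> R) a x : 'M[R]_d :=
  let ua := fun y => u (param a y) in
  \matrix_(i, j) (partial i (partial j ua) x
                  - \sum_k christoffel a k i j x * partial k ua x).

Definition ricci_flat : Prop := forall a x, chart_image a x -> ricci a x = 0.

Definition quasi_einstein (r : nat) (rho : R) (h : M -> R) : Prop :=
  [/\ is_semi_riemannian,
      smooth_fun h,
      forall p, h p != 0
    & forall a x, chart_image a x ->
        ricci a x - (r%:R / h (param a x)) *: hessian h a x
        = rho *: metric a x].

End SemiRiemannian.

Definition pseudo_euclidean (R : realType) (n : nat) (eps : 'rV[R]_n) :
    metric_atlas R n :=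
  @MetricAtlas R n 'rV[R]_n unit (fun _ => setT) (fun _ => id) (fun _ => id)
    (fun _ _ => diag_mx eps).

(* The metric of M divided by phi ^+ 2. *)
Definition conformal (R : realType) (d : nat) (M : metric_atlas R d)
    (phi : M -> R) : metric_atlas R d :=
  @MetricAtlas R d M (chart M) (@dom R d M) (@coords R d M) (@param R d M)
    (fun a x => (phi (param a x) ^+ 2)^-1 *: metric a x).

Definition warped_product (R : realType) (n m : nat) (B : metric_atlas R n)
    (f : B -> R) (F : metric_atlas R m) : metric_atlas R (n + m) :=
  @MetricAtlas R (n + m) (B * F)%type (chart B * chart F)%type
    (fun c => dom c.1 `*` dom c.2)
    (fun c p => row_mx (coords c.1 p.1) (coords c.2 p.2))
    (fun c z => (param c.1 (lsubmx z), param c.2 (rsubmx z)))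
    (fun c z => block_mx (metric c.1 (lsubmx z)) 0
                  0 (f (param c.1 (lsubmx z)) ^+ 2 *: metric c.2 (rsubmx z))).

(* Main.v *)
(** Every component of the warped metric is a product u(xi) * v(y), with u a
function of the null linear form xi and v a function of the fibre coordinates,
and so is every Christoffel symbol. As alpha is null, the contractions of these
symbols with eps and alpha vanish or reduce to alpha_j * alpha_k. Hence the base
block of Ric - (r / h) Hess h is alpha_j * alpha_k times a scalar function of
xi, namely the left-hand side of the differential equation divided by
f * phi * h. The mixed blocks vanish, and the fibre block is the Ricci tensor of
F. The equation, being linear of second order with smooth coefficients, makes h
smooth. *)

Require Import Defs.
From HB Require Import structures.
From mathcomp Require Import all_boot all_order all_algebra.
From mathcomp Require Import all_classical all_reals all_analysis.
From mathcomp Require Import ring.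
Import Order.TTheory GRing.Theory Num.Theory.
Import numFieldNormedType.Exports.

Set Implicit Arguments.
Unset Strict Implicit.
Unset Printing Implicit Defensive.

Local Open Scope ring_scope.
Local Open Scope classical_set_scope.

(** * Smooth functions of one variable *)

(** Geometrically, the gradient of xi is a null vector, so functions of xi have null gradient and
    vanishing Laplacian for the conformal metric as well; these are the terms of the conformal and
    warped product formulas that would otherwise survive. What remains on the base is alpha_j *
    alpha_k times (n - 2) phi''/phi - m (f''/f + 2 phi' f' / (phi f)) for Ric, and times h'' + 2
    phi' h' / phi for Hess h. The products u(xi) * v(y) are stable under partial derivatives up to
    constants: a base direction i gives alpha_i u' v, a fibre direction gives u times a partial of
    v. All calculus thus becomes calculus in one variable or calculus on F. Coordinate expressions
    are meaningful only on the open chart images, so an identity between them is differentiated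
    through equality near a point. *)

Section SmoothRealFunctions.
Variable R : realType.
Implicit Types (u v : R -> R) (N : nat).

(** Smoothness is cut down to finite order because the derivative of a product or of an inverse
    contains the functions themselves again: an induction on the order needs them only to the order
    already reached. *)
Definition differentiable_upto N u :=
  forall k, (k < N)%N -> forall t, derivable (u^`(k)) t 1.

Lemma smooth1P u : smooth1 u <-> forall N, differentiable_upto N u.
Proof. by split=> [su N k _ t|su k t]; [exact: su|exact: (su k.+1 k)]. Qed.

Lemma differentiable_upto0 u : differentiable_upto 0 u.
Proof. by []. Qed.

Lemma differentiable_uptoS N u : differentiable_upto N.+1 u <->
  (forall t, derivable u t 1) /\ differentiable_upto N (u^`())%classic.
Proof.
split=> [su|[du su] [|k] kN t].
- split=> [t|k kN t]; first exact: (su 0%N).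
  by rewrite -derive1Sn; exact: su.
- exact: du.
- by rewrite derive1Sn; exact: su.
Qed.

Lemma differentiable_uptoW N u :
  differentiable_upto N.+1 u -> differentiable_upto N u.
Proof. by move=> su k kN; apply: su; exact: ltnW. Qed.

Lemma differentiable_uptoD N u v : differentiable_upto N u ->
  differentiable_upto N v -> differentiable_upto N (fun t => u t + v t).
Proof.
elim: N u v => [|N IH] u v su sv; first exact: differentiable_upto0.
move: su sv => /differentiable_uptoS[du su] /differentiable_uptoS[dv sv].
apply/differentiable_uptoS; split=> [t|]; first exact: derivableD.
have -> : ((fun t => u t + v t)^`())%classic
        = fun t => (u^`())%classic t + (v^`())%classic t.
  by apply/funext => t; rewrite !derive1E deriveD.
exact: IH.
Qed.

Lemma derive1M u v t : derivable u t 1 -> derivable v t 1 ->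
  ((fun t => u t * v t)^`())%classic t
  = u t * (v^`())%classic t + (u^`())%classic t * v t.
Proof.
move=> du dv; rewrite !derive1E (deriveM du dv); congr (_ + _).
exact: mulrC.
Qed.

Lemma differentiable_uptoM N u v : differentiable_upto N u ->
  differentiable_upto N v -> differentiable_upto N (fun t => u t * v t).
Proof.
elim: N u v => [|N IH] u v su sv; first exact: differentiable_upto0.
move: (su) (sv) => /differentiable_uptoS[du su'] /differentiable_uptoS[dv sv'].
apply/differentiable_uptoS; split=> [t|]; first exact: derivableM.
have -> : ((fun t => u t * v t)^`())%classic
        = fun t => u t * (v^`())%classic t + (u^`())%classic t * v t.
  by apply/funext => t; rewrite derive1M.
apply: differentiable_uptoD.
  exact: (IH _ _ (differentiable_uptoW su) sv').
exact: (IH _ _ su' (differentiable_uptoW sv)).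
Qed.

Lemma derive1V u t : u t != 0 -> derivable u t 1 ->
  ((fun t => (u t)^-1)^`())%classic t = - (u^`())%classic t / u t ^+ 2.
Proof.
move=> u0 du; rewrite !derive1E (deriveV u0 du) /GRing.scale /=.
by ring.
Qed.

Lemma derive1_sqr u t : derivable u t 1 ->
  ((fun t => u t ^+ 2)^`())%classic t = 2 * u t * (u^`())%classic t.
Proof.
move=> du; transitivity (u t * (u^`())%classic t + (u^`())%classic t * u t).
  exact: (@derive1M u u t du du).
by ring.
Qed.

Lemma derive1_sqrV u t : u t != 0 -> derivable u t 1 ->
  ((fun t => (u t ^+ 2)^-1)^`())%classic t
  = - 2 * (u^`())%classic t / u t ^+ 3.
Proof.
move=> u0 du; have n2 : u t ^+ 2 != 0 by rewrite expf_neq0.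
have d2 : derivable (fun t => u t ^+ 2) t 1 by exact: (derivableM du du).
rewrite (@derive1V (fun t => u t ^+ 2) t n2 d2) (derive1_sqr du).
by field.
Qed.

Lemma derive1_opp u t : derivable u t 1 ->
  ((fun t => - u t)^`())%classic t = - (u^`())%classic t.
Proof. by move=> du; rewrite !derive1E (deriveN du). Qed.

Lemma derive1_div u v t : v t != 0 -> derivable u t 1 -> derivable v t 1 ->
  ((fun t => u t / v t)^`())%classic t
  = ((u^`())%classic t * v t - u t * (v^`())%classic t) / v t ^+ 2.
Proof.
move=> v0 du dv; have dV := derivableV v0 dv.
rewrite (@derive1M u (fun t => (v t)^-1) t du dV) (derive1V v0 dv).
by field.
Qed.

Lemma derive1n_cst (c : R) k :
  ((fun _ => c)^`(k))%classic = (fun _ => if k is 0%N then c else 0).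
Proof.
elim: k => [//|k IH]; rewrite derive1nS IH; apply/funext => t.
exact: (derive1_cst (_ : R)).
Qed.

Lemma smooth1_cst (c : R) : smooth1 (fun _ => c).
Proof. by move=> k t; rewrite derive1n_cst; exact: derivable_cst. Qed.
Arguments smooth1_cst : clear implicits.

Lemma smooth1_id : smooth1 (@id R).
Proof.
case=> [t|k t]; first exact: derivable_id.
rewrite derive1Sn; have -> : (id^`())%classic = (fun _ : R => 1 : R).
  by apply/funext => s; exact: derive1_id.
exact: smooth1_cst.
Qed.

Lemma smooth1D {u v} : smooth1 u -> smooth1 v -> smooth1 (fun t => u t + v t).
Proof.
by move=> /smooth1P su /smooth1P sv; apply/smooth1P => N;
  exact: differentiable_uptoD.
Qed.

Lemma smooth1M {u v} : smooth1 u -> smooth1 v -> smooth1 (fun t => u t * v t).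
Proof.
by move=> /smooth1P su /smooth1P sv; apply/smooth1P => N;
  exact: differentiable_uptoM.
Qed.

Lemma smooth1N {u} : smooth1 u -> smooth1 (fun t => - u t).
Proof.
move=> su; rewrite (_ : (fun t => - u t) = fun t => -1 * u t); last first.
  by apply/funext => t; rewrite mulN1r.
exact: (smooth1M (smooth1_cst (-1)) su).
Qed.

Lemma smooth1X {u} : smooth1 u -> smooth1 (fun t => u t ^+ 2).
Proof. by move=> su; exact: smooth1M. Qed.

(** The derivative of 1/u is - u' * (1/u)^2, which has order N as soon as 1/u has order N. *)
Lemma smooth1V {u} : smooth1 u -> (forall t, u t != 0) ->
  smooth1 (fun t => (u t)^-1).
Proof.
move=> /smooth1P su u0; apply/smooth1P; elim=> [|N IH].
  exact: differentiable_upto0.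
have /differentiable_uptoS[du su'] := su N.+1.
apply/differentiable_uptoS; split=> [t|]; first exact: derivableV.
have -> : ((fun t => (u t)^-1)^`())%classic
        = fun t => ((-1) * (u^`())%classic t) * ((u t)^-1 * (u t)^-1).
  by apply/funext => t; rewrite derive1V // expr2 invfM mulN1r.
have /smooth1P s1 := smooth1_cst (-1).
exact: (differentiable_uptoM (differentiable_uptoM (s1 N) su')
  (differentiable_uptoM IH IH)).
Qed.

Lemma smooth1_derive {u} : smooth1 u -> smooth1 (u^`())%classic.
Proof. by move=> su k t; rewrite -derive1Sn; exact: su. Qed.

Lemma smooth1_derivable {u} : smooth1 u -> forall t, derivable u t 1.
Proof. by move=> su; exact: (su 0%N). Qed.

(** Bootstrapping: if h is differentiable up to order N + 1, the right-hand side is so up to order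
    N, hence h up to order N + 2. *)
Lemma smooth1_linear_ode2 (a b h : R -> R) : smooth1 a -> smooth1 b ->
  (forall t, derivable h t 1) -> (forall t, derivable (h^`())%classic t 1) ->
  (forall t, (h^`(2))%classic t = a t * (h^`())%classic t + b t * h t) ->
  smooth1 h.
Proof.
move=> /smooth1P sa /smooth1P sb dh dh' ode; apply/smooth1P.
suff H N : differentiable_upto N.+1 h.
  by move=> N; exact: differentiable_uptoW.
elim: N => [|N IH].
  apply/differentiable_uptoS; split; first exact: dh.
  exact: differentiable_upto0.
have /differentiable_uptoS[_ IH'] := IH.
apply/differentiable_uptoS; split; first exact: dh.
apply/differentiable_uptoS; split; first exact: dh'.
have -> : (h^`()^`())%classic = fun t => a t * (h^`())%classic t + b t * h t.
  by apply/funext => t; rewrite -ode.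
apply: differentiable_uptoD; first exact: (differentiable_uptoM (sa N) IH').
exact: (differentiable_uptoM (sb N) (differentiable_uptoW IH)).
Qed.

End SmoothRealFunctions.

(** * Product topology *)

Section ProductTopology.

Lemma hausdorff_prod (S T : topologicalType) :
  hausdorff_space S -> hausdorff_space T -> hausdorff_space (S * T)%type.
Proof.
move=> hS hT [x1 x2] [y1 y2] cl; congr pair.
- apply: hS => A B nA nB.
  have [] := cl (A `*` setT) (B `*` setT).
  + by exists (A, setT) => //; split => //; exact: filterT.
  + by exists (B, setT) => //; split => //; exact: filterT.
  by move=> [p1 p2] [[? _] [? _]]; exists p1.
- apply: hT => A B nA nB.
  have [] := cl (setT `*` A) (setT `*` B).
  + by exists (setT, A) => //; split => //; exact: filterT.
  + by exists (setT, B) => //; split => //; exact: filterT.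
  by move=> [p1 p2] [[_ ?] [_ ?]]; exists p2.
Qed.

Lemma open_setX (S T : topologicalType) (A : set S) (B : set T) :
  open A -> open B -> open (A `*` B).
Proof.
move=> oA oB; rewrite openE => -[x y] [/= Ax By].
by exists (A, B) => //; split; exact: open_nbhs_nbhs.
Qed.

Lemma second_countable_prod (S T : topologicalType) : @second_countable S ->
  @second_countable T -> @second_countable (S * T)%type.
Proof.
move=> [BS cS [oS bS]] [BT cT [oT bT]].
exists ((fun AB => AB.1 `*` AB.2) @` (BS `*` BT)).
  exact/(card_le_trans (card_image_le _ _))/countableX.
split=> [_ [[A B] [/= BA BB] <-]|[x y] U [[A B] /= [nA nB] AB]].
  by apply: open_setX; [exact: oS|exact: oT].
have [A' [BA' A'x] sA] := bS x A nA.
have [B' [BB' B'y] sB] := bT y B nB.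
exists (A' `*` B').
  by split => //; exists (A', B').
by move=> [p q] [/= /sA Ap /sB Bq]; exact: AB.
Qed.

(** The countable base consists of the open boxes with rational corner matrices. *)
Lemma second_countable_mx (R : realType) (m n : nat) :
  @second_countable 'M[R]_(m, n).
Proof.
pose box (pq : 'M[rat]_(m, n) * 'M[rat]_(m, n)) := [set M : 'M[R]_(m, n) |
  forall i j, ratr (pq.1 i j) < M i j < ratr (pq.2 i j)].
exists (range box).
  exact/(card_le_trans (card_image_le _ _))/countableP.
split=> [_ [pq _ <-]|M U [P nP sP]].
  rewrite openE => M bM; exists (fun i j => `]ratr (pq.1 i j), ratr (pq.2 i j)[).
    move=> i j; apply: open_nbhs_nbhs; split; first exact: interval_open.
    by rewrite /= in_itv; exact: bM.
  by move=> N bN i j; have := bN i j; rewrite /= in_itv.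
(* Entrywise, a ball around [M i j] inside [P i j] leaves room for a rational on either side. *)
have ratP i j : exists pq : rat * rat, ratr pq.1 < M i j < ratr pq.2 /\
    `]ratr pq.1, ratr pq.2[ `<=` P i j.
  have /nbhs_ballP[e e0 sb] := nP i j.
  have lt1 : M i j - e < M i j by rewrite ltrBlDr ltrDl.
  have lt2 : M i j < M i j + e by rewrite ltrDl.
  have [q1] := rat_in_itvoo lt1; have [q2] := rat_in_itvoo lt2.
  rewrite !in_itv /= => /andP[q2l q2r] /andP[q1l q1r]; exists (q1, q2).
  split; first by rewrite /= q1r.
  move=> t; rewrite /= in_itv /= => /andP[t1 t2]; apply: sb.
  rewrite /ball /= ltr_distlC.
  by rewrite (lt_trans q1l t1) (lt_trans t2 q2r).
pose pq i j := projT1 (cid (ratP i j)).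
pose c := (\matrix_(i, j) (pq i j).1, \matrix_(i, j) (pq i j).2).
exists (box c).
  split; first by exists c.
  by move=> i j; rewrite !mxE; have [] := projT2 (cid (ratP i j)).
move=> N bN; apply: sP => i j; have [_] := projT2 (cid (ratP i j)); apply.
by rewrite /= in_itv; have := bN i j; rewrite !mxE.
Qed.

Lemma continuous_row_mx {T : topologicalType} {R : realType} {n m : nat}
    (u : T -> 'rV[R]_n) (v : T -> 'rV[R]_m) (p : T) :
  {for p, continuous u} -> {for p, continuous v} ->
  {for p, continuous (fun q => row_mx (u q) (v q))}.
Proof.
move=> cu cv A [P nP sP].
have nu : nbhs (u p) [set x | forall i j, P i (lshift m j) (x i j)].
  exists (fun i j => P i (lshift m j)) => // i j.
  by have := nP i (lshift m j); rewrite row_mxEl.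
have nv : nbhs (v p) [set x | forall i j, P i (rshift n j) (x i j)].
  exists (fun i j => P i (rshift n j)) => // i j.
  by have := nP i (rshift n j); rewrite row_mxEr.
have cu' : nbhs p [set q | forall i j, P i (lshift m j) (u q i j)] := cu _ nu.
have cv' : nbhs p [set q | forall i j, P i (rshift n j) (v q i j)] := cv _ nv.
suff: nbhs p [set q | A (row_mx (u q) (v q))] by [].
apply: filterS2 cu' cv' => q uq vq; apply: sP => i j.
case: (split_ordP j) => k ->; first by rewrite row_mxEl; exact: uq.
by rewrite row_mxEr; exact: vq.
Qed.

End ProductTopology.

(** * Products of a function of a linear form and a fibre function *)

Section SplitFunctions.
Variables (R : realType) (n m : nat).
Implicit Types (al : 'rV[R]_n) (u : R -> R) (v : 'rV[R]_m -> R)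
  (z : 'rV[R]_(n + m)).

Definition lin_form al (x : 'rV[R]_n) : R := \sum_(i < n) al 0 i * x 0 i.

Definition split_fun al u v z := u (lin_form al (lsubmx z)) * v (rsubmx z).

(** The difference quotients of the two sides are the same function. This turns directional
    derivatives into derivatives in one real variable. *)
Lemma derive_line (V : normedModType R) (w : V -> R) (x e : V) :
  'D_1 (fun t : R => w (t *: e + x)) 0 = 'D_e w x.
Proof.
rewrite /derive; set g1 := fun h => h^-1 *: _; set g2 := fun h => h^-1 *: _.
suff -> : g1 = g2 by [].
by apply/funext => t; rewrite /g1 /g2 /= addr0 scale0r add0r [_%:A]mulr1.
Qed.

Lemma is_derive_line (V : normedModType R) (w : V -> R) (x e : V) (d : R) :
  is_derive (0 : R) (1 : R) (fun t => w (t *: e + x)) d -> is_derive x e w d.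
Proof.
move=> [dw <-]; rewrite derive_line.
exact/derivableP/(derivable1P w x e).2.
Qed.

(** Along a base coordinate line the fibre factor is constant and the linear form is affine with
    slope [al 0 i], so the chain rule in one variable applies. *)
Lemma is_derive_split_lshift al u v z i :
  derivable u (lin_form al (lsubmx z)) 1 ->
  is_derive z (delta_mx 0 (lshift m i)) (split_fun al u v)
    (al 0 i * split_fun al (u^`())%classic v z).
Proof.
move=> du; apply: is_derive_line.
set xi := lin_form al (lsubmx z) in du *.
have E : (fun t : R => split_fun al u v (t *: delta_mx 0 (lshift m i) + z))
       = (fun t => v (rsubmx z) * u (t * al 0 i + xi)).
  apply/funext => t; rewrite /split_fun mulrC; congr (v _ * u _).
    apply/rowP => j; rewrite !mxE eqxx /= (_ : _ == _ = false) ?mulr0 ?add0r //.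
    by apply/negbTE; rewrite eq_sym eq_lrshift.
  rewrite /xi /lin_form (eq_bigr (fun k => t * (al 0 k * (k == i)%:R)
      + al 0 k * lsubmx z 0 k)).
    rewrite big_split /= -mulr_sumr (bigD1 i) //= eqxx mulr1 big1 ?addr0 //.
    by move=> k /negbTE ->; rewrite mulr0.
  move=> k _; rewrite !mxE eqxx /= (inj_eq (@lshift_inj _ _)).
  by rewrite mulrDr mulrCA.
rewrite E.
pose l := fun t : R => t * al 0 i + xi.
have [dl Dl] : is_derive (0 : R) (1 : R) l (al 0 i).
  apply: is_derive_eq; rewrite /= scaler0 add0r addr0.
  by rewrite /GRing.scale /= mulr1.
have du0 : derivable u (l 0) 1 by rewrite /l mul0r add0r.
have dc : derivable (u \o l) 0 1.
  apply/derivable1_diffP; exact: differentiable_comp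
    ((derivable1_diffP _ _).1 dl) ((derivable1_diffP _ _).1 du0).
have Dc : 'D_1 (u \o l) 0 = (u^`())%classic xi * al 0 i.
  rewrite -derive1E (derive1_comp dl du0) [(l^`())%classic _]derive1E Dl.
  by rewrite /l mul0r add0r.
rewrite /split_fun -/xi; move: (v (rsubmx z)) => c; split.
  exact: (derivableM (derivable_cst c _ _) dc).
have -> : 'D_1 (fun t : R => c * u (t * al 0 i + xi)) 0 = c * 'D_1 (u \o l) 0.
  exact: (deriveMl c dc).
by rewrite Dc mulrC -mulrA mulrCA.
Qed.

Arguments is_derive_split_lshift al u v z i : clear implicits.

Lemma is_derive_split_rshift al u v z j :
  derivable v (rsubmx z) (delta_mx 0 j) ->
  is_derive z (delta_mx 0 (rshift n j)) (split_fun al u v)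
    (split_fun al u (partial j v) z).
Proof.
move=> dv; apply: is_derive_line.
have E : (fun t : R => split_fun al u v (t *: delta_mx 0 (rshift n j) + z))
       = (fun t => u (lin_form al (lsubmx z)) * v (t *: delta_mx 0 j + rsubmx z)).
  apply/funext => t; rewrite /split_fun; congr (u (lin_form al _) * v _).
    apply/rowP => k; rewrite !mxE eqxx /= (_ : _ == _ = false) ?mulr0 ?add0r //.
    by rewrite eq_lrshift.
  by apply/rowP => k; rewrite !mxE eqxx /= (inj_eq (@rshift_inj _ _)).
rewrite E; have dc := (derivable1P _ _ _).1 dv.
split; first exact: (derivableM (derivable_cst _ _ _) dc).
rewrite [LHS](deriveMl (u (lin_form al (lsubmx z))) dc) /split_fun; congr (_ * _).
exact: derive_line.
Qed.

Arguments is_derive_split_rshift al u v z j : clear implicits.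

Lemma continuous_lin_form al : continuous (lin_form al).
Proof.
apply: continuous_big => [|i _ x]; first exact: add_continuous.
have := @cvgM _ _ (nbhs x) _ (fun=> al 0 i) (fun y : 'rV[R]_n => y 0 i).
by apply; [exact: cvg_cst|exact: coord_continuous].
Qed.

Lemma continuous_split al u v z :
  {for lin_form al (lsubmx z), continuous u} ->
  {for rsubmx z, continuous v} -> {for z, continuous (split_fun al u v)}.
Proof.
move=> cu cv.
have cl : {for z, continuous (fun y : 'rV[R]_(n + m) => lin_form al (lsubmx y))}.
  have cls := @continuous_lsubmx R 1 n m z.
  exact: (continuous_comp cls (@continuous_lin_form al (lsubmx z))).
have crs := @continuous_rsubmx R 1 n m z.
exact: (cvgM (continuous_comp cl cu) (continuous_comp crs cv)).
Qed.

Lemma smooth_on_split {al u v} {V : set 'rV[R]_m} : open V -> smooth1 u ->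
  smooth_on V v -> smooth_on [set z | V (rsubmx z)] (split_fun al u v).
Proof.
move=> oV su sv.
have nV z : V (rsubmx z) -> \forall y \near z, V (rsubmx y).
  have crs := @continuous_rsubmx R 1 n m z.
  by move=> Vz; apply: crs; exact: open_nbhs_nbhs.
(* [c] is the product of the entries of [al] at the base indices in [s], [k] is the number of these
   indices, and [s'] lists the fibre indices. *)
have key s : exists (c : R) (k : nat) (s' : seq 'I_m), forall z, V (rsubmx z) ->
    foldr (@partial R (n + m)) (split_fun al u v) s z
    = c * split_fun al (u^`(k))%classic (foldr (@partial R m) v s') z.
  elim: s => [|i s [c [k [s' IH]]]].
    by exists 1, 0%N, [::] => z _; rewrite mul1r.
  case: (split_ordP i) => j ->.
    exists (c * al 0 j), k.+1, s' => z Vz /=; rewrite {1}/partial.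
    pose w := foldr (@partial R m) v s'.
    (* The formula is valid only over [V]; as [V] is open it holds near [z], which is what
       differentiating it requires. *)
    have nE : \near z, foldr (@partial R (n + m)) (split_fun al u v) s z
        = c * split_fun al (u^`(k))%classic w z.
      by apply: filterS (nV z Vz) => y; exact: IH.
    rewrite (near_eq_derive _ nE).
    have [d e] := is_derive_split_lshift al (u^`(k))%classic w z j (su k _).
    by rewrite (deriveMl c d) e mulrA.
  exists c, k, (j :: s') => z Vz /=; rewrite {1}/partial.
  pose w := foldr (@partial R m) v s'.
  have nE : \near z, foldr (@partial R (n + m)) (split_fun al u v) s z
        = c * split_fun al (u^`(k))%classic w z.
    by apply: filterS (nV z Vz) => y; exact: IH.
  rewrite (near_eq_derive _ nE).
  have dw : derivable w (rsubmx z) (delta_mx 0 j) by have [_] := sv s' _ Vz.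
  have [d e] := is_derive_split_rshift al (u^`(k))%classic w z j dw.
  by rewrite (deriveMl c d) e.
move=> s z Vz /=; have [c [k [s' E]]] := key s.
have [cv dv] := sv s' _ Vz.
have nE : \near z, c * split_fun al (u^`(k))%classic (foldr (@partial R m) v s') z
        = foldr (@partial R (n + m)) (split_fun al u v) s z.
  by apply: filterS (nV z Vz) => y Vy; rewrite E.
split.
  rewrite /prop_for /continuous_at E //.
  apply: cvg_trans (near_eq_cvg nE) _; apply: cvgM; first exact: cvg_cst.
  apply: continuous_split => //.
  exact/differentiable_continuous/derivable1_diffP/su.
move=> i; apply: (near_eq_derivable nE).
case: (split_ordP i) => j ->.
  have [d _] := is_derive_split_lshift al (u^`(k))%classic
    (foldr (@partial R m) v s') z j (su k _).
  exact: (derivableM (derivable_cst _ _ _) d).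
have [d _] := is_derive_split_rshift al (u^`(k))%classic _ z j (dv j).
exact: (derivableM (derivable_cst _ _ _) d).
Qed.

Lemma smooth_on_cst d (V : set 'rV[R]_d) (c : R) : smooth_on V (fun _ => c).
Proof.
move=> s x _.
have [c' ->] : exists c', foldr (@partial R d) (fun _ => c) s = fun _ => c'.
  elim: s => [|i s [c' /= ->]]; first by exists c.
  by exists 0; apply/funext => y; exact: derive_cst.
by split=> [|i]; [exact: (@cst_continuous _ _ c' x)|exact: derivable_cst].
Qed.

End SplitFunctions.

(** * Partial derivatives of split functions, Kronecker sums *)

Section Partials.
Variable R : realType.

Lemma near_eq_partial d (i : 'I_d) (u v : 'rV[R]_d -> R) (x : 'rV[R]_d) :
  (\near x, u x = v x) -> partial i u x = partial i v x.
Proof. exact: near_eq_derive. Qed.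

Lemma partial_cst d (i : 'I_d) (c : R) : partial i (fun _ => c) = fun _ => 0.
Proof. by apply/funext => x; exact: derive_cst. Qed.

Lemma partial_split_lshift n m (al : 'rV[R]_n) u v (z : 'rV[R]_(n + m)) i :
  smooth1 u ->
  partial (lshift m i) (split_fun al u v) z
  = al 0 i * split_fun al (u^`())%classic v z.
Proof.
move=> su; have du : derivable u (lin_form al (lsubmx z)) 1.
  exact: smooth1_derivable.
by have [_ <-] := is_derive_split_lshift v i du.
Qed.

Lemma partial_split_rshift n m (al : 'rV[R]_n) u v (z : 'rV[R]_(n + m)) j :
  derivable v (rsubmx z) (delta_mx 0 j) ->
  partial (rshift n j) (split_fun al u v) z = split_fun al u (partial j v) z.
Proof. by move=> dv; have [_ <-] := is_derive_split_rshift al u dv. Qed.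

(** Both sides are the derivative of the same function of one variable, so the equality holds for
    every [v], in particular for the Christoffel symbols of F, whose differentiability is not
    established. *)
Lemma partial_rsubmx n m (v : 'rV[R]_m -> R) (z : 'rV[R]_(n + m)) j :
  partial (rshift n j) (fun y => v (rsubmx y)) z = partial j v (rsubmx z).
Proof.
have E : (fun t : R => v (rsubmx (t *: delta_mx 0 (rshift n j) + z)))
       = (fun t : R => v (t *: delta_mx 0 j + rsubmx z)).
  apply/funext => t; congr v; apply/rowP => k.
  by rewrite !mxE eqxx /= (inj_eq (@rshift_inj _ _)).
rewrite /partial -(derive_line v) -E.
by rewrite (derive_line (fun y : 'rV[R]_(n + m) => v (rsubmx y))).
Qed.

Lemma sum_delta d (F : 'I_d -> R) (k : 'I_d) :
  \sum_(i < d) F i * (i == k)%:R = F k.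
Proof.
rewrite (bigD1 k) //= eqxx mulr1 big1 ?addr0 // => i /negbTE ->.
by rewrite mulr0.
Qed.

Lemma sum_deltaC d (F : 'I_d -> R) (k : 'I_d) :
  \sum_(i < d) F i * (k == i)%:R = F k.
Proof. by under eq_bigr do rewrite eq_sym; exact: sum_delta. Qed.

Lemma invmx_unique d (A B : 'M[R]_d) : A *m B = 1%:M -> invmx A = B.
Proof.
move=> AB; have [uA _] := mulmx1_unit AB.
by rewrite -[RHS](mulKmx uA) AB mulmx1.
Qed.

End Partials.

(* [A] stands for alpha_i * alpha_j; [f, f1, f2] for f, f', f'' at a point, and
   similarly for [p] (that is, phi) and [h]. *)
Lemma warped_ode_identity (K : fieldType) (A n m N f f1 f2 p p1 p2 h h1 h2 : K) :
  f != 0 -> p != 0 -> h != 0 ->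
  - N * f * p * h2 - 2 * N * f * p1 * h1
    + ((n - 2) * f * p2 - m * p * f2 - 2 * m * p1 * f1) * h = 0 ->
  A * ((2 - n) * ((p1 ^+ 2 - p2 * p) / p ^+ 2) + (n - 2) * (- (p1 / p)) ^+ 2
       - m * ((f2 * f - f1 ^+ 2) / f ^+ 2 + (f1 / f) ^+ 2
              - 2 * (- (p1 / p)) * (f1 / f)))
  - N / h * (A * (h2 - 2 * (- (p1 / p)) * h1)) = 0.
Proof.
(* Divided by f * p * h and multiplied by A, the equation has the claimed expression as its
   left-hand side; [<-] puts it in place of the 0 on the right. *)
move=> f0 p0 h0 /(congr1 (fun E => A * (E / (f * p * h)))).
by rewrite mul0r mulr0 => <-; field; rewrite f0 p0 h0.
Qed.

(** * Curvature of the warped product *)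

Section WarpedProduct.
Variables (R : realType) (n m : nat) (eps alpha : 'rV[R]_n).
Hypothesis eps_sqr : forall i, eps 0 i * eps 0 i = 1.
Hypothesis alpha_null : \sum_(i < n) eps 0 i * alpha 0 i ^+ 2 = 0.
Variables f phi : R -> R.
Hypotheses (f_smooth : smooth1 f) (f_neq0 : forall t, f t != 0).
Hypotheses (phi_smooth : smooth1 phi) (phi_neq0 : forall t, phi t != 0).
Variable F : metric_atlas R m.
Hypothesis F_semi : is_semi_riemannian F.

Definition warped : metric_atlas R (n + m) :=
  @warped_product R n m
    (conformal (M := pseudo_euclidean eps) (fun x => phi (lin_form alpha x)))
    (fun x => f (lin_form alpha x)) F.

Local Notation l := (@lshift n m).
Local Notation r := (@rshift n m).
Local Notation f' := (f^`())%classic.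
Local Notation phi' := (phi^`())%classic.

Definition xi (z : 'rV[R]_(n + m)) : R := lin_form alpha (lsubmx z).

(* These are the factors depending on xi in the Christoffel symbols of type
   (base; base, base), (fibre; base, fibre) and (base; fibre, fibre);
   [base_symbol] is the constant factor in the first type. *)
Definition base_coef (t : R) : R := - (phi' t / phi t).
Definition mixed_coef (t : R) : R := f' t / f t.
Definition fibre_coef (t : R) : R := - (phi t ^+ 2 * f t * f' t).
Definition base_symbol (k i j : 'I_n) : R :=
  alpha 0 i * (j == k)%:R + alpha 0 j * (i == k)%:R
  - eps 0 i * eps 0 k * alpha 0 k * (i == j)%:R.
Local Notation p := base_coef.
Local Notation q := mixed_coef.
Local Notation w := fibre_coef.

(** * Metric and Christoffel symbols in a chart *)

Section Chart.
Variable a : chart F.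
Local Notation c := ((tt, a) : chart warped).
Local Notation W := [set z : 'rV[R]_(n + m) | chart_image a (rsubmx z)].

Lemma openW : open W.
Proof.
have [[_ _ oF _ _] _] := F_semi; have [_ oU] := oF a.
rewrite openE => z Wz; have crs := @continuous_rsubmx R 1 n m z.
by apply: crs; exact: open_nbhs_nbhs.
Qed.

Lemma nearW z : W z -> \forall y \near z, W y.
Proof. by move=> Wz; apply: open_nbhs_nbhs; split => //; exact: openW. Qed.

Lemma metric_sym y : chart_image a y -> forall j k,
  metric a y j k = metric a y k j.
Proof.
have [_ [_ sF _ _]] := F_semi; move=> Uy j k.
by rewrite -[in LHS](sF _ _ Uy) mxE.
Qed.

(** Invertibility is read off the index: the product of [P], the metric and [P^T] is diagonal with
    entries 1 and -1. *)
Lemma metric_unit y : chart_image a y -> metric a y \in unitmx.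
Proof.
have [_ [_ _ [q iF] _]] := F_semi; move=> Uy.
have [P [N [uP _ E]]] := iF _ _ Uy.
have : P *m metric a y *m P^T \in unitmx.
  rewrite E unitmxE det_diag unitfE; apply/prodf_neq0 => i _.
  by rewrite mxE signr_eq0.
by rewrite !unitmx_mul => /andP[/andP[]].
Qed.

Lemma invmx_metricK y : chart_image a y -> forall j k,
  \sum_s invmx (metric a y) j s * metric a y k s = (j == k)%:R.
Proof.
move=> Uy j k; have := mulVmx (metric_unit Uy).
move=> /matrixP /(_ j k); rewrite !mxE => <-.
by apply: eq_bigr => s _; rewrite metric_sym.
Qed.

Lemma derivable_metric y : chart_image a y -> forall j k i,
  derivable (fun y => metric a y j k) y (delta_mx 0 i).
Proof.
have [_ [sF _ _ _]] := F_semi; move=> Uy j k i.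
by have [_] := sF a j k [::] y Uy; exact.
Qed.

Lemma metric_ll i j : (fun z => metric c z (l i) (l j)) =
  split_fun alpha (fun t => (phi t ^+ 2)^-1) (fun _ => eps 0 i * (i == j)%:R).
Proof.
by apply/funext => z; rewrite /= block_mxEul !mxE mulr_natr.
Qed.

Lemma metric_lr i j : (fun z => metric c z (l i) (r j)) = fun _ => 0.
Proof. by apply/funext => z; rewrite /= block_mxEur mxE. Qed.

Lemma metric_rl i j : (fun z => metric c z (r i) (l j)) = fun _ => 0.
Proof. by apply/funext => z; rewrite /= block_mxEdl mxE. Qed.

Lemma metric_rr i j : (fun z => metric c z (r i) (r j)) =
  split_fun alpha (fun t => f t ^+ 2) (fun y => metric a y i j).
Proof. by apply/funext => z; rewrite /= block_mxEdr !mxE. Qed.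

Lemma smooth_phiV2 : smooth1 (fun t => (phi t ^+ 2)^-1).
Proof.
by apply: smooth1V; [exact: smooth1X|move=> t; rewrite expf_neq0].
Qed.

Lemma derive1_phiV2 t :
  ((fun t => (phi t ^+ 2)^-1)^`())%classic t = - 2 * phi' t / phi t ^+ 3.
Proof.
apply: derive1_sqrV; first exact: phi_neq0.
exact: (smooth1_derivable phi_smooth).
Qed.

Lemma derive1_f2 t : ((fun t => f t ^+ 2)^`())%classic t = 2 * f t * f' t.
Proof.
by apply: derive1_sqr; exact: (smooth1_derivable f_smooth).
Qed.

Lemma partial_l_ll i j k z : partial (l i) (fun z => metric c z (l j) (l k)) z =
  alpha 0 i * (- 2 * phi' (xi z) / phi (xi z) ^+ 3) * (eps 0 j * (j == k)%:R).
Proof.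
rewrite metric_ll partial_split_lshift; last exact: smooth_phiV2.
by rewrite /split_fun derive1_phiV2 mulrA.
Qed.

Lemma partial_r_ll i j k z : partial (r i) (fun z => metric c z (l j) (l k)) z = 0.
Proof.
rewrite metric_ll partial_split_rshift; last exact: derivable_cst.
by rewrite /split_fun partial_cst mulr0.
Qed.

Lemma partial_lr i j k z : partial i (fun z => metric c z (l j) (r k)) z = 0.
Proof. by rewrite metric_lr partial_cst. Qed.

Lemma partial_rl i j k z : partial i (fun z => metric c z (r j) (l k)) z = 0.
Proof. by rewrite metric_rl partial_cst. Qed.

Lemma partial_l_rr i j k z : partial (l i) (fun z => metric c z (r j) (r k)) z =
  alpha 0 i * (2 * f (xi z) * f' (xi z)) * metric a (rsubmx z) j k.
Proof.
rewrite metric_rr partial_split_lshift; last exact: smooth1X.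
by rewrite /split_fun derive1_f2 mulrA.
Qed.

Lemma partial_r_rr i j k z : W z ->
  partial (r i) (fun z => metric c z (r j) (r k)) z =
  f (xi z) ^+ 2 * partial i (fun y => metric a y j k) (rsubmx z).
Proof.
move=> Wz; rewrite metric_rr partial_split_rshift //.
exact: derivable_metric.
Qed.

(** As the entries of [eps] square to 1, [diag_mx eps] is its own inverse. *)
Lemma invmx_metric z : W z -> invmx (metric c z) =
  block_mx (phi (xi z) ^+ 2 *: diag_mx eps) 0
           0 ((f (xi z) ^+ 2)^-1 *: invmx (metric a (rsubmx z))).
Proof.
move=> Wz; apply: invmx_unique; rewrite mulmx_block.
rewrite !mul0mx !mulmx0 !addr0 !add0r -!scalemxAl -!scalemxAr !scalerA.
rewrite mulmxV ?metric_unit // mulVf ?expf_neq0 // mulfV ?expf_neq0 //.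
rewrite !scale1r (_ : diag_mx eps *m diag_mx eps = 1%:M) ?scalar_mx_block //.
by apply/matrixP => i j; rewrite mul_diag_mx !mxE mulrnAr eps_sqr.
Qed.

Lemma christoffel_l k i j z : W z -> christoffel c (l k) i j z =
  2^-1 * phi (xi z) ^+ 2 * eps 0 k *
    (partial i (fun z => metric c z j (l k)) z
     + partial j (fun z => metric c z i (l k)) z
     - partial (l k) (fun z => metric c z i j) z).
Proof.
move=> Wz; rewrite /christoffel invmx_metric // big_split_ord.
rewrite [X in _ * (_ + X)]big1 ?addr0; last first.
  by move=> s _; rewrite block_mxEur mxE mul0r.
rewrite (bigD1 k) // big1 ?Monoid.mulm1; last first.
  move=> s /negbTE sk; rewrite block_mxEul !mxE eq_sym sk.
  by rewrite mulr0n mulr0 mul0r.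
rewrite block_mxEul !mxE eqxx mulr1n.
by rewrite !mulrA.
Qed.

Lemma christoffel_r k i j z : W z -> christoffel c (r k) i j z =
  2^-1 * (f (xi z) ^+ 2)^-1 *
    \sum_s invmx (metric a (rsubmx z)) k s *
      (partial i (fun z => metric c z j (r s)) z
       + partial j (fun z => metric c z i (r s)) z
       - partial (r s) (fun z => metric c z i j) z).
Proof.
move=> Wz; rewrite /christoffel invmx_metric // big_split_ord.
rewrite [X in _ * (X + _)]big1 ?add0r; last first.
  by move=> s _; rewrite block_mxEdl mxE mul0r.
rewrite -[RHS]mulrA [X in _ = _ * X]mulr_sumr; congr (_ * _).
apply: eq_bigr => s _.
by rewrite block_mxEdr !mxE mulrA.
Qed.

Lemma eps_delta j k : eps 0 j * (j == k)%:R = eps 0 k * (j == k)%:R.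
Proof. by case: eqP => [->|]; rewrite ?mulr0. Qed.

Lemma christoffel_lll k i j z : W z ->
  christoffel c (l k) (l i) (l j) z
  = split_fun alpha p (fun _ => base_symbol k i j) z.
Proof.
move=> Wz; rewrite christoffel_l // !partial_l_ll (eps_delta j k) (eps_delta i k).
rewrite /split_fun /base_symbol -/(xi z) /base_coef; move: (phi_neq0 (xi z)).
set P := phi _; set P' := phi' _ => P0.
(* The factor [eps 0 k * eps 0 k], produced by moving [eps] to the index k, is kept visible because
   [field] does not know that it equals 1. *)
transitivity (- (P' / P) * (eps 0 k * eps 0 k *
  (alpha 0 i * (j == k)%:R + alpha 0 j * (i == k)%:R)
   - eps 0 i * eps 0 k * alpha 0 k * (i == j)%:R)); first by field.
by rewrite eps_sqr mul1r.
Qed.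

Lemma christoffel_llr k i j z : W z -> christoffel c (l k) (l i) (r j) z = 0.
Proof.
move=> Wz; rewrite christoffel_l // partial_rl partial_lr partial_r_ll.
by rewrite subr0 addr0 mulr0.
Qed.

Lemma christoffel_lrl k i j z : W z -> christoffel c (l k) (r i) (l j) z = 0.
Proof.
move=> Wz; rewrite christoffel_l // !partial_rl partial_r_ll.
by rewrite subr0 addr0 mulr0.
Qed.

Lemma christoffel_lrr k i j z : W z -> christoffel c (l k) (r i) (r j) z =
  split_fun alpha w (fun y => eps 0 k * alpha 0 k * metric a y i j) z.
Proof.
move=> Wz; rewrite christoffel_l // !partial_rl partial_l_rr.
by rewrite /split_fun /fibre_coef -/(xi z); field.
Qed.

Lemma christoffel_rll k i j z : W z -> christoffel c (r k) (l i) (l j) z = 0.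
Proof.
move=> Wz; rewrite christoffel_r // big1 ?mulr0 // => s _.
by rewrite !partial_lr partial_r_ll subr0 addr0 mulr0.
Qed.

Lemma christoffel_rlr k i j z : W z -> christoffel c (r k) (l i) (r j) z =
  split_fun alpha q (fun _ => alpha 0 i * (k == j)%:R) z.
Proof.
move=> Wz; rewrite christoffel_r //.
under eq_bigr => s _ do
  rewrite !partial_lr partial_l_rr subr0 addr0 mulrCA.
rewrite -mulr_sumr invmx_metricK // /split_fun /mixed_coef -/(xi z).
by field; exact: f_neq0.
Qed.

Lemma christoffel_rrl k i j z : W z -> christoffel c (r k) (r i) (l j) z =
  split_fun alpha q (fun _ => alpha 0 j * (k == i)%:R) z.
Proof.
move=> Wz; rewrite christoffel_r //.
under eq_bigr => s _ do
  rewrite partial_lr partial_rl partial_l_rr subr0 add0r mulrCA.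
rewrite -mulr_sumr invmx_metricK // /split_fun /mixed_coef -/(xi z).
by field; exact: f_neq0.
Qed.

Lemma christoffel_rrr k i j z : W z ->
  christoffel c (r k) (r i) (r j) z = christoffel a k i j (rsubmx z).
Proof.
move=> Wz; rewrite christoffel_r // /christoffel -[LHS]mulrA.
rewrite [X in _ * X = _]mulr_sumr.
congr (_ * _); apply: eq_bigr => s _; rewrite !partial_r_rr //.
by field; exact: f_neq0.
Qed.

(** The metric is symmetric only on the chart image; this set is open, so the symmetry can be
    differentiated. *)
Lemma christoffel_sym y k i j : chart_image a y ->
  christoffel a k i j y = christoffel a k j i y.
Proof.
move=> Uy; rewrite /christoffel; congr (_ * _); apply: eq_bigr => s _.
congr (_ * _); rewrite [X in X - _]addrC; congr (_ - _).
apply: near_eq_partial; have [[_ _ oF _ _] _] := F_semi.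
have : nbhs y (chart_image a) by apply: open_nbhs_nbhs; split => //; apply: (oF a).2.
by apply: filterS => y' Uy'; exact: metric_sym.
Qed.

(** * Derivatives of the Christoffel symbols *)

Lemma base_coef_smooth : smooth1 p.
Proof.
exact: smooth1N
  (smooth1M (smooth1_derive phi_smooth) (smooth1V phi_smooth phi_neq0)).
Qed.

Lemma mixed_coef_smooth : smooth1 q.
Proof. exact: smooth1M (smooth1_derive f_smooth) (smooth1V f_smooth f_neq0). Qed.

Lemma fibre_coef_smooth : smooth1 w.
Proof.
exact: smooth1N (smooth1M (smooth1M (smooth1X phi_smooth) f_smooth)
  (smooth1_derive f_smooth)).
Qed.

Lemma partial_l_christoffel_lll t k i j z : W z ->
  partial (l t) (christoffel c (l k) (l i) (l j)) z
  = alpha 0 t * (p^`()%classic (xi z) * base_symbol k i j).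
Proof.
move=> Wz; rewrite -(partial_split_lshift alpha (fun=> base_symbol k i j) z t
  base_coef_smooth).
apply: near_eq_partial; apply: filterS (nearW Wz) => y Wy.
exact: christoffel_lll.
Qed.

Lemma partial_r_christoffel_lll t k i j z : W z ->
  partial (r t) (christoffel c (l k) (l i) (l j)) z = 0.
Proof.
move=> Wz; transitivity
  (partial (r t) (split_fun alpha p (fun=> base_symbol k i j)) z).
  apply: near_eq_partial; apply: filterS (nearW Wz) => y Wy.
  exact: christoffel_lll.
rewrite partial_split_rshift; last exact: derivable_cst.
by rewrite /split_fun partial_cst mulr0.
Qed.

Lemma partial_near0 t u z : W z -> (forall y, W y -> u y = 0) ->
  partial t u z = 0.
Proof.
move=> Wz u0; rewrite -[RHS](congr1 (@^~ z) (partial_cst t 0)).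
by apply: near_eq_partial; apply: filterS (nearW Wz) => y /u0.
Qed.

Lemma partial_christoffel_llr t k i j z : W z ->
  partial t (christoffel c (l k) (l i) (r j)) z = 0.
Proof. by move=> Wz; apply: partial_near0 => // y; exact: christoffel_llr. Qed.

Lemma partial_christoffel_lrl t k i j z : W z ->
  partial t (christoffel c (l k) (r i) (l j)) z = 0.
Proof. by move=> Wz; apply: partial_near0 => // y; exact: christoffel_lrl. Qed.

Lemma partial_christoffel_rll t k i j z : W z ->
  partial t (christoffel c (r k) (l i) (l j)) z = 0.
Proof. by move=> Wz; apply: partial_near0 => // y; exact: christoffel_rll. Qed.

Lemma partial_l_christoffel_lrr t k i j z : W z ->
  partial (l t) (christoffel c (l k) (r i) (r j)) z
  = alpha 0 t * (w^`()%classic (xi z) *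
      (eps 0 k * alpha 0 k * metric a (rsubmx z) i j)).
Proof.
move=> Wz; rewrite -(partial_split_lshift alpha
  (fun y => eps 0 k * alpha 0 k * metric a y i j) z t fibre_coef_smooth).
apply: near_eq_partial; apply: filterS (nearW Wz) => y Wy.
exact: christoffel_lrr.
Qed.

Lemma partial_r_christoffel_rlr t k i j z : W z ->
  partial (r t) (christoffel c (r k) (l i) (r j)) z = 0.
Proof.
move=> Wz; transitivity
  (partial (r t) (split_fun alpha q (fun=> alpha 0 i * (k == j)%:R)) z).
  apply: near_eq_partial; apply: filterS (nearW Wz) => y Wy.
  exact: christoffel_rlr.
rewrite partial_split_rshift; last exact: derivable_cst.
by rewrite /split_fun partial_cst mulr0.
Qed.

Lemma partial_l_christoffel_rrl t k i j z : W z ->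
  partial (l t) (christoffel c (r k) (r i) (l j)) z
  = alpha 0 t * (q^`()%classic (xi z) * (alpha 0 j * (k == i)%:R)).
Proof.
move=> Wz; rewrite -(partial_split_lshift alpha
  (fun=> alpha 0 j * (k == i)%:R) z t mixed_coef_smooth).
apply: near_eq_partial; apply: filterS (nearW Wz) => y Wy.
exact: christoffel_rrl.
Qed.

Lemma partial_r_christoffel_rrl t k i j z : W z ->
  partial (r t) (christoffel c (r k) (r i) (l j)) z = 0.
Proof.
move=> Wz; transitivity
  (partial (r t) (split_fun alpha q (fun=> alpha 0 j * (k == i)%:R)) z).
  apply: near_eq_partial; apply: filterS (nearW Wz) => y Wy.
  exact: christoffel_rrl.
rewrite partial_split_rshift; last exact: derivable_cst.
by rewrite /split_fun partial_cst mulr0.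
Qed.

Lemma partial_l_christoffel_rrr t k i j z : W z ->
  partial (l t) (christoffel c (r k) (r i) (r j)) z = 0.
Proof.
move=> Wz; transitivity
  (partial (l t) (split_fun alpha (fun=> 1) (christoffel a k i j)) z).
  apply: near_eq_partial; apply: filterS (nearW Wz) => y Wy.
  by rewrite christoffel_rrr // /split_fun mul1r.
rewrite partial_split_lshift; last exact: smooth1_cst.
by rewrite /split_fun derive1_cst mul0r mulr0.
Qed.

Lemma partial_r_christoffel_rrr t k i j z : W z ->
  partial (r t) (christoffel c (r k) (r i) (r j)) z
  = partial t (christoffel a k i j) (rsubmx z).
Proof.
move=> Wz; rewrite -partial_rsubmx.
apply: near_eq_partial; apply: filterS (nearW Wz) => y Wy.
exact: christoffel_rrr.
Qed.

(** * Contractions with the null covector and the Ricci tensor *)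

Lemma alpha_null_mul : \sum_(i < n) alpha 0 i * (eps 0 i * alpha 0 i) = 0.
Proof. by rewrite -[RHS]alpha_null; apply: eq_bigr => i _; rewrite mulrCA. Qed.

(** There is no summation over i: the first and third terms cancel because [eps 0 i] squares to
    1. *)
Lemma base_symbol_diag i k : base_symbol i i k = alpha 0 k.
Proof.
rewrite /base_symbol eqxx mulr1 eps_sqr mul1r (eq_sym i k).
by rewrite [X in X - _]addrC addrK.
Qed.

(** Each Kronecker term contributes alpha_j * alpha_k; the third term contracts alpha with itself
    and vanishes. *)
Lemma sum_base_symbol j k : \sum_i alpha 0 i * base_symbol i j k = 2 * alpha 0 j * alpha 0 k.
Proof.
rewrite (eq_bigr (fun i => alpha 0 i * alpha 0 j * (k == i)%:R
  + alpha 0 i * alpha 0 k * (j == i)%:R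
  - (alpha 0 i * (eps 0 i * alpha 0 i)) * (eps 0 j * (j == k)%:R))); last first.
  by move=> i _; rewrite /base_symbol; ring.
rewrite sumrB big_split /= !sum_deltaC -mulr_suml alpha_null_mul mul0r subr0.
by ring.
Qed.

(** Expanding the first factor, the term alpha_j * alpha_k is counted once for each i, which gives
    n, and the term with j = i gives 2. In the remaining contraction one part is a multiple of the
    null sum and the other two cancel. *)
Lemma sum_base_symbol_mul j k : \sum_i \sum_s base_symbol i j s * base_symbol s i k
  = (n%:R + 2) * (alpha 0 j * alpha 0 k).
Proof.
have E i : \sum_s base_symbol i j s * base_symbol s i k =
    alpha 0 j * alpha 0 k + 2 * alpha 0 i * alpha 0 k * (j == i)%:R
    - eps 0 j * (eps 0 i * alpha 0 i) * base_symbol j i k.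
  rewrite (eq_bigr (fun s => alpha 0 j * base_symbol s i k * (s == i)%:R
    + (alpha 0 s * base_symbol s i k) * (j == i)%:R
    - eps 0 j * (eps 0 i * alpha 0 i) * base_symbol s i k * (j == s)%:R)); last first.
    by move=> s _; rewrite {1}/base_symbol; ring.
  by rewrite sumrB big_split /= sum_delta sum_deltaC -mulr_suml sum_base_symbol base_symbol_diag.
rewrite (eq_bigr _ (fun i _ => E i)) sumrB big_split /= sum_deltaC.
rewrite sumr_const card_ord.
under [X in _ - X]eq_bigr do rewrite -mulrA.
rewrite -mulr_sumr (eq_bigr (fun i => alpha 0 i * (eps 0 i * alpha 0 i) * (k == j)%:R
  + eps 0 i * alpha 0 i * alpha 0 k * (i == j)%:R
  - (eps 0 i * eps 0 i) * (alpha 0 i * eps 0 j * alpha 0 j) * (i == k)%:R)); last first.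
  by move=> i _; rewrite /base_symbol; ring.
rewrite sumrB big_split /= -mulr_suml alpha_null_mul mul0r !sum_delta eps_sqr.
by rewrite -mulr_natr; ring.
Qed.

(** The trace runs over n base and m fibre directions. On the base, p' gets 2 from [sum_base_symbol]
    and - n from the second derivative term; p^2 gets 2 n - (n + 2). Each fibre direction
    contributes 2 p q - q' - q^2. *)
Lemma ricci_ll j k z : W z -> ricci c z (l j) (l k) =
  alpha 0 j * alpha 0 k *
    ((2 - n%:R) * p^`()%classic (xi z) + (n%:R - 2) * p (xi z) ^+ 2
     - m%:R * (q^`()%classic (xi z) + q (xi z) ^+ 2
               - 2 * p (xi z) * q (xi z))).
Proof.
move=> Wz; rewrite mxE big_split_ord /=.
set P := p (xi z); set Q := q (xi z).
set P' := (p^`()%classic _); set Q' := (q^`()%classic _).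
have El i : riemann c (l i) (l i) (l j) (l k) z =
    P' * (alpha 0 i * base_symbol i j k) - P' * (alpha 0 j * alpha 0 k)
    + P ^+ 2 * (2 * (alpha 0 j * alpha 0 k))
    - P ^+ 2 * \sum_s base_symbol i j s * base_symbol s i k.
  rewrite /riemann !(partial_l_christoffel_lll _ _ _ _ Wz) base_symbol_diag big_split_ord.
  rewrite [X in _ + (_ + X)]big1; last first.
    move=> s _; rewrite !(christoffel_rll _ _ _ Wz) !mulr0; exact: subr0.
  rewrite (eq_bigr (fun s => P ^+ 2 * (alpha 0 s * base_symbol s j k)
    - P ^+ 2 * (base_symbol i j s * base_symbol s i k))); last first.
    move=> s _; rewrite !(christoffel_lll _ _ _ Wz) base_symbol_diag /split_fun -/(xi z).
    by rewrite -/P; ring.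
  rewrite sumrB -!mulr_sumr sum_base_symbol -/P'; set S := \sum_s _.
  by rewrite /=; ring.
have Er b : riemann c (r b) (r b) (l j) (l k) z =
    alpha 0 j * alpha 0 k * (2 * P * Q - Q' - Q ^+ 2).
  rewrite /riemann (partial_christoffel_rll _ _ _ _ Wz).
  rewrite (partial_l_christoffel_rrl _ _ _ _ Wz) eqxx mulr1 big_split_ord.
  rewrite (eq_bigr (fun s => P * Q * (alpha 0 s * base_symbol s j k))); last first.
    move=> s _; rewrite (christoffel_rll _ _ _ Wz) (christoffel_rrl _ _ _ Wz).
    rewrite (christoffel_lll _ _ _ Wz) eqxx mulr1 /split_fun -/(xi z) -/P -/Q.
    by ring.
  rewrite -mulr_sumr sum_base_symbol.
  rewrite (eq_bigr (fun s => - (Q ^+ 2 * alpha 0 j * alpha 0 k * (b == s)%:R)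
     * (b == s)%:R)); last first.
    move=> s _; rewrite !(christoffel_rll _ _ _ Wz) (christoffel_rrl _ _ _ Wz).
    rewrite (christoffel_rlr _ _ _ Wz) /split_fun -/(xi z) -/Q (eq_sym s b).
    by ring.
  by rewrite sum_deltaC eqxx -/Q' /=; ring.
rewrite (eq_bigr _ (fun i _ => El i)) (eq_bigr _ (fun b _ => Er b)).
rewrite sumrB big_split /= sumrB -!mulr_sumr sum_base_symbol sum_base_symbol_mul.
rewrite !sumr_const !card_ord.
by ring.
Qed.

(** Every summand of the trace vanishes: in a fibre direction d, the symbol (d; d, b) of F occurs
    twice with opposite signs. *)
Lemma ricci_lr j b z : W z -> ricci c z (l j) (r b) = 0.
Proof.
move=> Wz; rewrite mxE big_split_ord /= big1 ?big1 ?addr0 //.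
- move=> d _; rewrite /riemann (partial_r_christoffel_rlr _ _ _ _ Wz).
  rewrite (partial_l_christoffel_rrr _ _ _ _ Wz) big_split_ord.
  rewrite big1; last first.
    move=> s _; rewrite (christoffel_llr _ _ _ Wz) (christoffel_rll _ _ _ Wz).
    by rewrite mulr0 mul0r; exact: subr0.
  rewrite (eq_bigr (fun s => q (xi z) * alpha 0 j *
    (christoffel a d d s (rsubmx z) * (s == b)%:R
     - christoffel a s d b (rsubmx z) * (d == s)%:R))); last first.
    move=> s _; rewrite !(christoffel_rrr _ _ _ Wz) !(christoffel_rlr _ _ _ Wz).
    by rewrite /split_fun -/(xi z); ring.
  rewrite -mulr_sumr sumrB sum_delta sum_deltaC.
  by rewrite /=; ring.
- move=> i _; rewrite /riemann !(partial_christoffel_llr _ _ _ _ Wz).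
  rewrite big_split_ord /= !big1 ?addr0 ?subr0 //.
  + by move=> s _; rewrite !(christoffel_llr _ _ _ Wz) !mul0r subr0.
  + by move=> s _; rewrite !(christoffel_llr _ _ _ Wz) !mulr0 subr0.
Qed.

(** Here the symbols of F left over are (d; d, b) and (d; b, d), which cancel only by
    [christoffel_sym]. *)
Lemma ricci_rl b k z : W z -> ricci c z (r b) (l k) = 0.
Proof.
move=> Wz; rewrite mxE big_split_ord /= big1 ?big1 ?addr0 //.
- move=> d _; rewrite /riemann !(partial_r_christoffel_rrl _ _ _ _ Wz).
  rewrite big_split_ord big1; last first.
    move=> s _; rewrite !(christoffel_lrl _ _ _ Wz) !mulr0; exact: subr0.
  rewrite (eq_bigr (fun s => q (xi z) * alpha 0 k *
    (christoffel a d d s (rsubmx z) * (s == b)%:R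
     - christoffel a d b s (rsubmx z) * (s == d)%:R))); last first.
    move=> s _; rewrite !(christoffel_rrr _ _ _ Wz) !(christoffel_rrl _ _ _ Wz).
    by rewrite /split_fun -/(xi z); ring.
  rewrite -mulr_sumr sumrB !sum_delta (christoffel_sym _ b d Wz).
  by rewrite /=; ring.
- move=> i _; rewrite /riemann (partial_christoffel_lrl _ _ _ _ Wz).
  rewrite (partial_r_christoffel_lll _ _ _ _ Wz).
  rewrite big_split_ord /= !big1 ?addr0 ?subr0 //.
  + move=> s _; rewrite (christoffel_llr _ _ _ Wz) (christoffel_rll _ _ _ Wz).
    by rewrite mulr0 mul0r subr0.
  + by move=> s _; rewrite !(christoffel_lrl _ _ _ Wz) mulr0 mul0r subr0.
Qed.

(** The corrections to the Ricci tensor of F carry the null sum as a factor. For base directions it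
    appears only after summing over i; for fibre directions it is already the inner sum over the
    base index s. *)
Lemma ricci_rr b d z : W z ->
  ricci c z (r b) (r d) = ricci a (rsubmx z) b d.
Proof.
move=> Wz; rewrite mxE big_split_ord /=.
set P := p (xi z); set Q := q (xi z); set V := w (xi z).
set V' := (w^`()%classic (xi z)).
have El i : riemann c (l i) (l i) (r b) (r d) z =
    alpha 0 i * (eps 0 i * alpha 0 i) * ((V' - V * Q) * metric a (rsubmx z) b d).
  rewrite /riemann (partial_l_christoffel_lrr _ _ _ _ Wz).
  rewrite (partial_christoffel_llr _ _ _ _ Wz) big_split_ord.
  rewrite (eq_bigr (fun s => alpha 0 s * (eps 0 s * alpha 0 s) *
      (P * V * metric a (rsubmx z) b d))); last first.
    move=> s _; rewrite (christoffel_lrl _ _ _ Wz) (christoffel_lll _ _ _ Wz).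
    rewrite (christoffel_lrr _ _ _ Wz) base_symbol_diag /split_fun -/(xi z) -/P -/V.
    by ring.
  rewrite -mulr_suml alpha_null_mul mul0r.
  rewrite (eq_bigr (fun s => - (V * Q * (alpha 0 i * (eps 0 i * alpha 0 i)) *
      metric a (rsubmx z) b s) * (s == d)%:R)); last first.
    move=> s _; rewrite (christoffel_llr _ _ _ Wz) (christoffel_lrr _ _ _ Wz).
    rewrite (christoffel_rlr _ _ _ Wz) /split_fun -/(xi z) -/Q -/V.
    by ring.
  by rewrite sum_delta -/V' /=; ring.
have Er e : riemann c (r e) (r e) (r b) (r d) z
    = riemann a e e b d (rsubmx z).
  rewrite /riemann !(partial_r_christoffel_rrr _ _ _ _ Wz); congr (_ + _).
  rewrite big_split_ord.
  rewrite (eq_bigr (fun s => alpha 0 s * (eps 0 s * alpha 0 s) *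
      (Q * V * (metric a (rsubmx z) b d
                - (e == b)%:R * metric a (rsubmx z) e d)))); last first.
    move=> s _; rewrite !(christoffel_rrl _ _ _ Wz) !(christoffel_lrr _ _ _ Wz).
    rewrite eqxx mulr1 /split_fun -/(xi z) -/Q -/V.
    by ring.
  rewrite -mulr_suml alpha_null_mul mul0r [LHS]add0r.
  by apply: eq_bigr => s _; rewrite !(christoffel_rrr _ _ _ Wz).
rewrite (eq_bigr _ (fun i _ => El i)) (eq_bigr _ (fun e _ => Er e)).
by rewrite -mulr_suml alpha_null_mul mul0r mxE [LHS]add0r.
Qed.

(** * Hessian of h and the quasi-Einstein equation *)

Section Hessian.
Variable h : R -> R.
Hypothesis h_smooth : smooth1 h.
Local Notation h' := (h^`())%classic.
Local Notation h'' := (h^`(2))%classic.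
Local Notation hM := (fun s : warped => h (lin_form alpha s.1)).

Lemma partial_l_lift j : partial (l j) (fun y => hM (param c y))
  = split_fun alpha h' (fun=> alpha 0 j).
Proof.
have -> : (fun y => hM (param c y)) = split_fun alpha h (fun=> 1).
  by apply/funext => y; rewrite /split_fun mulr1.
apply/funext => y; rewrite partial_split_lshift //.
by rewrite /split_fun mulr1 mulrC.
Qed.

Lemma partial_r_lift b : partial (r b) (fun y => hM (param c y)) = fun=> 0.
Proof.
have -> : (fun y => hM (param c y)) = split_fun alpha h (fun=> 1).
  by apply/funext => y; rewrite /split_fun mulr1.
apply/funext => y; rewrite partial_split_rshift; last exact: derivable_cst.
by rewrite /split_fun partial_cst mulr0.
Qed.

Lemma hessian_ll j k z : W z -> hessian hM c z (l j) (l k) =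
  alpha 0 j * alpha 0 k * (h'' (xi z) - 2 * p (xi z) * h' (xi z)).
Proof.
move=> Wz; rewrite mxE partial_l_lift partial_split_lshift; last first.
  exact: smooth1_derive.
rewrite big_split_ord /= [X in _ - (_ + X)]big1 ?addr0; last first.
  by move=> s _; rewrite (christoffel_rll _ _ _ Wz) mul0r.
rewrite (eq_bigr (fun s => p (xi z) * h' (xi z) * (alpha 0 s * base_symbol s j k))).
  by rewrite -mulr_sumr sum_base_symbol /split_fun -/(xi z); ring.
move=> s _; rewrite (christoffel_lll _ _ _ Wz) partial_l_lift /split_fun -/(xi z).
by ring.
Qed.

Lemma hessian_lr j b z : W z -> hessian hM c z (l j) (r b) = 0.
Proof.
move=> Wz; rewrite mxE partial_r_lift partial_cst big_split_ord /=.
rewrite !big1 ?addr0 ?subr0 //.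
- by move=> s _; rewrite partial_r_lift mulr0.
- by move=> s _; rewrite (christoffel_llr _ _ _ Wz) mul0r.
Qed.

Lemma hessian_rl b k z : W z -> hessian hM c z (r b) (l k) = 0.
Proof.
move=> Wz; rewrite mxE partial_l_lift partial_split_rshift; last first.
  exact: derivable_cst.
rewrite /split_fun partial_cst mulr0 big_split_ord /= !big1 ?addr0 ?subr0 //.
- by move=> s _; rewrite partial_r_lift mulr0.
- by move=> s _; rewrite (christoffel_lrl _ _ _ Wz) mul0r.
Qed.

(** Up to factors, the Christoffel term is the inner product of the gradients of f and h, both
    multiples of the null gradient of xi. *)
Lemma hessian_rr b d z : W z -> hessian hM c z (r b) (r d) = 0.
Proof.
move=> Wz; rewrite mxE partial_r_lift partial_cst big_split_ord /=.
rewrite [X in _ - (_ + X)]big1 ?addr0; last first.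
  by move=> s _; rewrite partial_r_lift mulr0.
rewrite (eq_bigr (fun s => alpha 0 s * (eps 0 s * alpha 0 s) *
    (w (xi z) * metric a (rsubmx z) b d * h' (xi z)))); last first.
  move=> s _; rewrite (christoffel_lrr _ _ _ Wz) partial_l_lift /split_fun -/(xi z).
  by ring.
by rewrite -mulr_suml alpha_null_mul mul0r subr0.
Qed.

Lemma derive1_base_coef t : (p^`())%classic t
  = (phi' t ^+ 2 - (phi^`(2))%classic t * phi t) / phi t ^+ 2.
Proof.
have dphi : derivable phi t 1 by exact: smooth1_derivable.
have dphi' : derivable phi' t 1.
  by apply: smooth1_derivable; exact: smooth1_derive.
have dV := derivableV (phi_neq0 t) dphi.
rewrite (derive1_opp (derivableM dphi' dV)).
rewrite (derive1_div (phi_neq0 t) dphi' dphi).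
by rewrite derive1nS derive1n1; field.
Qed.

Lemma derive1_mixed_coef t : (q^`())%classic t
  = ((f^`(2))%classic t * f t - f' t ^+ 2) / f t ^+ 2.
Proof.
have df : derivable f t 1 by exact: smooth1_derivable.
have df' : derivable f' t 1.
  by apply: smooth1_derivable; exact: smooth1_derive.
rewrite (derive1_div (f_neq0 t) df' df).
by rewrite derive1nS derive1n1; field.
Qed.

Lemma warped_einstein_eq (N : nat) z : (forall t, h t != 0) ->
  (forall t, - N%:R * f t * phi t * (h^`(2))%classic t
       - 2 * N%:R * f t * phi' t * h' t
       + ((n%:R - 2) * f t * (phi^`(2))%classic t - m%:R * phi t * (f^`(2))%classic t
          - 2 * m%:R * phi' t * f' t) * h t = 0) ->
  ricci_flat F -> W z ->
  ricci c z - (N%:R / h (xi z)) *: hessian hM c z = 0.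
Proof.
move=> h0 ode flat Wz; apply/matrixP => I J; rewrite [RHS]mxE.
(* Stated for arbitrary matrices, so that [mxE] does not unfold the entries of [ricci] and
   [hessian]. *)
have entryE (A B : 'M[R]_(n + m)) s : (A - s *: B) I J = A I J - s * B I J.
  by rewrite !mxE.
rewrite {}entryE; case: (split_ordP I) => i ->; case: (split_ordP J) => j ->.
- rewrite (ricci_ll _ _ Wz) (hessian_ll _ _ Wz).
  rewrite derive1_base_coef derive1_mixed_coef /base_coef /mixed_coef.
  exact: (warped_ode_identity _ (f_neq0 _) (phi_neq0 _) (h0 _) (ode _)).
- by rewrite (ricci_lr _ _ Wz) (hessian_lr _ _ Wz) mulr0 subr0.
- by rewrite (ricci_rl _ _ Wz) (hessian_rl _ _ Wz) mulr0 subr0.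
- by rewrite (ricci_rr _ _ Wz) (hessian_rr _ _ Wz) flat // mxE mulr0 subr0.
Qed.

End Hessian.
End Chart.
End WarpedProduct.

(** * The warped product as a semi-Riemannian manifold *)

Section WarpedManifold.
Variables (R : realType) (n m : nat) (eps alpha : 'rV[R]_n).
Hypothesis eps_sqr : forall i, eps 0 i * eps 0 i = 1.
Variables f phi : R -> R.
Hypotheses (f_smooth : smooth1 f) (f_neq0 : forall t, f t != 0).
Hypotheses (phi_smooth : smooth1 phi) (phi_neq0 : forall t, phi t != 0).
Variable F : metric_atlas R m.
Hypothesis F_semi : is_semi_riemannian F.
Local Notation M := (warped eps alpha f phi F).
Local Notation chartM a := ((tt, a) : chart M).
Implicit Types a b : chart F.

Lemma domM a : dom (chartM a) = setT `*` dom a.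
Proof. by []. Qed.

Lemma image_coordsM a (D : set F) : coords (chartM a) @` (setT `*` D)
  = [set z | (coords a @` D) (rsubmx z)].
Proof.
apply/seteqP; split=> [_ [[x p] [_ Dp] <-]|z [p Dp E]] /=.
  by rewrite row_mxKr; exists p.
by exists (lsubmx z, p) => //=; rewrite E hsubmxK.
Qed.

Lemma chart_imageM a : chart_image (chartM a)
  = [set z | chart_image a (rsubmx z)].
Proof. exact: image_coordsM. Qed.

Lemma image_overlapM a b : coords (chartM a) @` (dom (chartM a) `&` dom (chartM b))
  = [set z | (coords a @` (dom a `&` dom b)) (rsubmx z)].
Proof.
rewrite -image_coordsM; congr (_ @` _).
by apply/seteqP; split=> [[x p] [[_ ?] [_ ?]]|[x p] [_ [? ?]]].
Qed.

(** [smooth_on_split] asks for an open set. The overlap is the part of the open chart image that the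
    continuous map [param a] sends into the open set [dom b]. *)
Lemma open_overlap a b : open (coords a @` (dom a `&` dom b)).
Proof.
have [[_ _ oF invF _] _] := F_semi.
have [oda oia] := oF a; have [odb _] := oF b.
have [pcK _ pcont] := invF a.
rewrite openE => _ [p [ap bp] <-].
have Uap : chart_image a (coords a p) by exists p.
have cpar := pcont _ Uap.
have nb : nbhs (coords a p) [set y | dom b (param a y)].
  by apply: cpar; rewrite pcK //; exact: open_nbhs_nbhs.
have na : nbhs (coords a p) (chart_image a) by exact: open_nbhs_nbhs.
apply: filterS (filterI na nb) => y [[p' ap' <-]]; rewrite /= pcK // => bp'.
by exists p'.
Qed.

Lemma lin_form_delta (x : 'rV[R]_n) j : lin_form (delta_mx 0 j) x = x 0 j.
Proof.
rewrite /lin_form -(sum_delta (fun i => x 0 i) j).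
by apply: eq_bigr => i _; rewrite mxE eqxx mulrC.
Qed.

(** A single base coordinate need not be a function of xi; it becomes a split function once a
    coordinate covector takes the place of alpha. *)
Lemma lsubmx_split (j : 'I_n) : (fun z : 'rV[R]_(n + m) => lsubmx z 0 j)
  = split_fun (delta_mx 0 j) id (fun=> 1).
Proof. by apply/funext => z; rewrite /split_fun lin_form_delta mulr1. Qed.

Lemma rsubmx_split (v : 'rV[R]_m -> R) :
  (fun z : 'rV[R]_(n + m) => v (rsubmx z)) = split_fun alpha (fun=> 1) v.
Proof. by apply/funext => z; rewrite /split_fun mul1r. Qed.

Lemma transitionM a b z : coords (chartM b) (param (chartM a) z)
  = row_mx (lsubmx z) (coords b (param a (rsubmx z))).
Proof. by []. Qed.

Lemma warped_manifold : is_smooth_manifold M.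
Proof.
have [[[hF cF] covF oF invF smF] _] := F_semi; split.
- split; first by apply: hausdorff_prod => //; exact: norm_hausdorff.
  by apply: second_countable_prod => //; exact: second_countable_mx.
- by move=> [x p]; have [a ap] := covF p; exists (chartM a).
- move=> [[] a]; have [oda oia] := oF a; split.
    by rewrite domM; apply: open_setX => //; exact: openT.
  by rewrite chart_imageM; exact: openW.
- move=> [[] a]; have [pcK ccont pcont] := invF a; split.
  + by move=> [x p] [_ ap] /=; rewrite row_mxKl row_mxKr pcK.
  + move=> [x p] [_ ap]; apply: (continuous_row_mx (u := fst)).
      exact: cvg_fst.
    apply: (continuous_comp (f := snd)); first exact: cvg_snd.
    exact: ccont.
  + move=> z; rewrite chart_imageM => Uz.
    have cls := @continuous_lsubmx R 1 n m z.
    have crs := @continuous_rsubmx R 1 n m z.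
    exact: (cvg_pair cls (continuous_comp crs (pcont _ Uz))).
- move=> [[] a] [[] b] k; rewrite image_overlapM.
  have ov := @open_overlap a b.
  case: (split_ordP k) => j ->.
    rewrite (_ : (fun _ => _) = split_fun (delta_mx 0 j) id (fun=> 1)).
      have s1 : smooth_on (coords a @` (dom a `&` dom b)) (fun=> 1 : R).
        exact: smooth_on_cst.
      have sid : smooth1 (@id R) by exact: smooth1_id.
      exact: (smooth_on_split ov sid s1).
    by rewrite -lsubmx_split; apply/funext => z; rewrite transitionM row_mxEl.
  rewrite (_ : (fun _ => _) = split_fun alpha (fun=> 1)
    (fun y => coords b (param a y) 0 j)).
    have s1 : smooth1 (fun=> 1 : R) by exact: smooth1_cst.
    exact: (smooth_on_split ov s1 (smF a b j)).
  by rewrite -rsubmx_split; apply/funext => z; rewrite transitionM row_mxEr.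
Qed.

Definition timelike : {set 'I_n} := [set i | eps 0 i != 1]%SET.

(** The index has to be one number for all points, so it must not depend on the values [x] of phi
    and [y] of f. *)
Lemma warped_has_index x y (g : 'M[R]_m) q : x != 0 -> y != 0 -> has_index g q ->
  has_index (block_mx ((x ^+ 2)^-1 *: diag_mx eps) 0 0 (y ^+ 2 *: g))
    (#|timelike| + q).
Proof.
move=> x0 y0 [P [N [uP cN E]]].
(* Scaling the base vectors by x and the fibre vectors by 1/y cancels the factors x^-2 and y^2 of
   the metric. *)
exists (block_mx x%:M 0 0 (y^-1 *: P)).
exists ((@lshift n m @: timelike) :|: (@rshift n m @: N)).
split.
- rewrite block_diag_mx_unit unitmxE det_scalar unitfE expf_neq0 //=.
  by rewrite unitmxZ // unitfE invr_eq0.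
- rewrite cardsU !card_imset ?cN; [|exact: rshift_inj|exact: lshift_inj].
  rewrite (_ : _ :&: _ = finset.set0) ?cards0 ?subn0 //.
  apply/setP => k; rewrite !inE; apply/negP => /andP[/imsetP[i _ ->]].
  by move=> /imsetP[j _ /eqP]; rewrite eq_lrshift.
- rewrite tr_block_mx !mulmx_block !trmx0 !mul0mx !mulmx0 !addr0 !add0r.
  have -> : x%:M *m ((x ^+ 2)^-1 *: diag_mx eps) *m (x%:M)^T = diag_mx eps.
    rewrite tr_scalar_mx mul_scalar_mx mul_mx_scalar !scalerA.
    by rewrite (_ : _ * _ = 1) ?scale1r //; field.
  have -> : y^-1 *: P *m (y ^+ 2 *: g) *m (y^-1 *: P)^T
      = diag_mx (\row_i (-1) ^+ (i \in N)).
    rewrite [(_ *: P)^T]linearZ /= -!scalemxAr -!scalemxAl !scalerA E.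
    by rewrite (_ : _ * _ = 1) ?scale1r //; field.
  rewrite !mul0mx -diag_mx_row; congr diag_mx; apply/rowP => k; rewrite !mxE.
  rewrite inE; case: (split_ordP k) => j ->.
    rewrite (mem_imset _ _ (@lshift_inj _ _)) inE.
    rewrite (_ : _ \in _ @: N = false) ?orbF.
      have := eps_sqr j; case: eqVneq => [->|e1] //=.
      by move=> /eqP; rewrite -expr2 sqrf_eq1 (negbTE e1) => /eqP ->.
    by apply/imsetP => -[i _ /eqP]; rewrite eq_lrshift.
  rewrite (mem_imset _ _ (@rshift_inj _ _)) mxE.
  rewrite (_ : _ \in _ @: timelike = false) //.
  by apply/imsetP => -[i _ /eqP]; rewrite eq_sym eq_lrshift.
Qed.

(** The base has a single chart with the identity as coordinates, so a transition map changes the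
    fibre coordinates only. *)
Lemma jacobianM a b z :
  jacobian_mx (fun y => coords (chartM b) (param (chartM a) y)) z
  = block_mx 1%:M 0 0 (jacobian_mx (fun y => coords b (param a y)) (rsubmx z)).
Proof.
apply/matrixP => I J; rewrite mxE; case: (split_ordP J) => j ->.
  rewrite (_ : (fun _ => _) = (fun y : 'rV[R]_(n + m) => lsubmx y 0 j)); last first.
    by apply/funext => y; rewrite transitionM row_mxEl.
  rewrite lsubmx_split; case: (split_ordP I) => i ->.
    rewrite block_mxEul partial_split_lshift; last exact: smooth1_id.
    by rewrite /split_fun derive1_id !mxE !mulr1 eqxx eq_sym.
  rewrite block_mxEdl partial_split_rshift; last exact: derivable_cst.
  by rewrite /split_fun partial_cst mulr0 mxE.
rewrite (_ : (fun _ => _) =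
    (fun y : 'rV[R]_(n + m) => coords b (param a (rsubmx y)) 0 j)); last first.
  by apply/funext => y; rewrite transitionM row_mxEr.
case: (split_ordP I) => i ->.
  rewrite (rsubmx_split (fun y => coords b (param a y) 0 j)) block_mxEur.
  rewrite partial_split_lshift; last exact: smooth1_cst.
  by rewrite /split_fun derive1_cst mul0r mulr0 mxE.
by rewrite block_mxEdr (partial_rsubmx (fun y => coords b (param a y) 0 j)) mxE.
Qed.

Lemma warped_metric : is_metric M.
Proof.
have [[_ _ oF _ _] [smF symF [q iF] trF]] := F_semi; split.
- move=> [[] a] I J; rewrite chart_imageM.
  have [_ oU] := oF a.
  case: (split_ordP I) => i ->; case: (split_ordP J) => j ->.
  + rewrite metric_ll.
    have sc : smooth_on (chart_image a) (fun=> eps 0 i * (i == j)%:R).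
      exact: smooth_on_cst.
    exact: (smooth_on_split oU (smooth_phiV2 phi_smooth phi_neq0) sc).
  + by rewrite metric_lr; exact: smooth_on_cst.
  + by rewrite metric_rl; exact: smooth_on_cst.
  + by rewrite metric_rr; exact: (smooth_on_split oU (smooth1X f_smooth) (smF a i j)).
- move=> [[] a] z; rewrite chart_imageM => Uz /=.
  by rewrite tr_block_mx !trmx0 !linearZ /= tr_diag_mx symF.
- exists (#|timelike| + q)%N => -[[] a] z; rewrite chart_imageM => Uz.
  by apply: warped_has_index; [exact: phi_neq0|exact: f_neq0|exact: iF].
(* Both charts share the base coordinates, so the conformal and warping factors agree and only the
   transformation law of F remains. *)
- move=> [[] a] [[] b] z; rewrite image_overlapM => Uz tau.
  rewrite /tau jacobianM transitionM /= row_mxKl row_mxKr.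
  rewrite tr_block_mx !mulmx_block !trmx0 trmx1 !mul0mx !mulmx0 !addr0 !add0r.
  rewrite !mul1mx !mulmx1 -!scalemxAr -!scalemxAl.
  by rewrite mul0mx -(trF a b _ Uz).
Qed.

End WarpedManifold.

(** * Regularity of h and the theorem *)

Lemma linear_ode2_normal_form (K : fieldType) (r n m y y1 y2 x x1 x2 h h1 h2 : K) :
  r != 0 -> y != 0 -> x != 0 ->
  - r * y * x * h2 - 2 * r * y * x1 * h1
    + ((n - 2) * y * x2 - m * x * y2 - 2 * m * x1 * y1) * h = 0 ->
  h2 = (-2) * (x1 / x) * h1
     + ((n - 2) * y * x2 + - (m * x * y2) + - (2 * m * x1 * y1)) / (r * y * x) * h.
Proof.
(* Dividing by the leading coefficient r * y * x and changing the sign isolates [h2]. *)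
move=> r0 y0 x0 /(congr1 (fun E => - (E / (r * y * x)))).
rewrite mul0r oppr0 => E; apply/eqP; rewrite -subr_eq0 -[X in _ == X]E.
by apply/eqP; field; rewrite r0 y0 x0.
Qed.

(** The leading coefficient r * f * phi has no zero, so the equation can be solved for h'' with
    smooth coefficients and bootstrapped. *)
Lemma ode_solution_smooth (R : realType) (f phi h : R -> R) (r n m : R) :
  r != 0 -> smooth1 f -> (forall t, f t != 0) ->
  smooth1 phi -> (forall t, phi t != 0) ->
  (forall t, derivable h t 1) -> (forall t, derivable (h^`())%classic t 1) ->
  (forall t, - r * f t * phi t * (h^`(2))%classic t
     - 2 * r * f t * (phi^`())%classic t * (h^`())%classic t
     + ((n - 2) * f t * (phi^`(2))%classic t - m * phi t * (f^`(2))%classic t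
        - 2 * m * (phi^`())%classic t * (f^`())%classic t) * h t = 0) ->
  smooth1 h.
Proof.
move=> r0 sf f0 sphi phi0 dh dh' ode.
pose A t := (-2) * ((phi^`())%classic t / phi t).
(* Differences of functions are written with opposites and second derivatives as iterated first
   ones, so that [B] has the shape that the closure lemmas produce. *)
pose B t := ((n - 2) * f t * (phi^`()^`())%classic t
  + - (m * phi t * (f^`()^`())%classic t)
  + - (2 * m * (phi^`())%classic t * (f^`())%classic t)) / (r * f t * phi t).
have sphi' := smooth1_derive sphi; have sf' := smooth1_derive sf.
have sphi2 := smooth1_derive sphi'; have sf2 := smooth1_derive sf'.
have sc (x : R) : smooth1 (fun=> x) by exact: smooth1_cst.
have sA : smooth1 A.
  exact: (smooth1M (sc (-2)) (smooth1M sphi' (smooth1V sphi phi0))).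
have den0 t : r * f t * phi t != 0 by rewrite !mulf_neq0.
have sB : smooth1 B.
  have t1 := smooth1M (smooth1M (sc (n - 2)) sf) sphi2.
  have t2 := smooth1N (smooth1M (smooth1M (sc m) sphi) sf2).
  have t3 := smooth1N (smooth1M (smooth1M (sc (2 * m)) sphi') sf').
  have t4 := smooth1M (smooth1M (sc r) sf) sphi.
  exact: (smooth1M (smooth1D (smooth1D t1 t2) t3) (smooth1V t4 den0)).
apply: (smooth1_linear_ode2 sA sB dh dh') => t.
exact: (linear_ode2_normal_form r0 (f0 t) (phi0 t) (ode t)).
Qed.

Theorem theorem2p8 (R : realType) (n m r : nat)
    (hn : (3 <= n)%N) (hm : (1 <= m)%N) (hr : (1 <= r)%N)
    (eps alpha : 'rV[R]_n)
    (heps : forall i, eps 0 i = 1 \/ eps 0 i = -1)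
    (halpha : \sum_(i < n) eps 0 i * alpha 0 i ^+ 2 = 0)
    (f phi h : R -> R)
    (f_smooth : smooth1 f) (f_pos : forall t : R, 0 < f t)
    (phi_smooth : smooth1 phi) (phi_pos : forall t : R, 0 < phi t)
    (h_diff : forall t : R, derivable h t 1)
    (h_diff2 : forall t : R, derivable (derive1 h) t 1)
    (h_neq0 : forall t : R, h t != 0)
    (h_ode : forall t : R,
       - r%:R * f t * phi t * derive1n 2 h t
       - 2 * r%:R * f t * derive1 phi t * derive1 h t
       + ((n%:R - 2) * f t * derive1n 2 phi t - m%:R * phi t * derive1n 2 f t
          - 2 * m%:R * derive1 phi t * derive1 f t) * h t = 0)
    (F : metric_atlas R m)
    (F_semi_riemannian : is_semi_riemannian F) (F_ricci_flat : ricci_flat F) :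
  let xi := fun x : 'rV[R]_n => \sum_(i < n) alpha 0 i * x 0 i in
  let B := conformal (M := pseudo_euclidean eps) (fun x => phi (xi x)) in
  let M := warped_product (B := B) (fun x => f (xi x)) F in
  quasi_einstein (M := M) r 0 (fun p => h (xi p.1)).
Proof.
move=> xi B M.
have f0 t : f t != 0 by rewrite gt_eqF.
have phi0 t : phi t != 0 by rewrite gt_eqF.
have eps_sqr i : eps 0 i * eps 0 i = 1.
  by have [->|->] := heps i; rewrite ?mulr1 ?mulrNN ?mulr1.
have r0 : r%:R != 0 :> R by rewrite pnatr_eq0 -lt0n.
have h_smooth : smooth1 h.
  exact: ode_solution_smooth r0 f_smooth f0 phi_smooth phi0 h_diff h_diff2 h_ode.
(* The local definitions of the statement unfold to [warped] and [lin_form], the forms used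
   above. *)
change (quasi_einstein (M := warped eps alpha f phi F) r 0
  (fun p => h (lin_form alpha p.1))).
split.
- split; first exact: warped_manifold.
  exact: warped_metric.
- move=> [[] a]; rewrite chart_imageM.
  have [[_ _ oF _ _] _] := F_semi_riemannian; have [_ oU] := oF a.
  have s1 : smooth_on (chart_image a) (fun=> 1 : R) by exact: smooth_on_cst.
  (* In a chart, the lift of h is the split function with fibre factor 1. *)
  have := smooth_on_split (al := alpha) oU h_smooth s1.
  congr (smooth_on _ _); apply/funext => z.
  by rewrite /split_fun mulr1.
- by move=> p; exact: h_neq0.
- move=> [[] a] z; rewrite chart_imageM => Uz; rewrite scale0r.
  exact: (warped_einstein_eq eps_sqr halpha f_smooth f0 phi_smooth phi0
    F_semi_riemannian h_smooth h_neq0 h_ode F_ricci_flat Uz).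
Qed.
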